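(* Let $A$ be a torsion-free abelian group and let $K$ be a direct product of torsion-free acylindrically hyperbolic groups. Then every existential formula is concise in the direct product $A\times K$; that is, for every existential formula $\varphi(x)$, if $(A\times K)_\varphi$ is finite, then the subgroup it generates is finite.
   Context: A formula is a first-order formula $\varphi(x)$ in the language of groups $\{1,\cdot,{}^{-1}\}$ with one free variable $x$ and without parameters. It is existential if the only quantifier occurring is $\exists$, i.e. it is equivalent to one of the form $\exists\overline y:\bigvee_{j=1}^m(w_{j,1}(x,\overline y)\#_{j,1}1\wedge\cdots\wedge w_{j,k_j}(x,\overline y)\#_{j,k_j}1)$, with each $w_{j,i}$ a (group) word and $\#_{j,i}\in\{=,\neq\}$. For a group $G$, $G_\varphi:=\{g\in G\mid\varphi(g)\text{ is true in }G\}$ and $\varphi(G):=\langle G_\varphi\rangle$. A formula $\varphi$ is concise in a group $G$ if finiteness of $G_\varphi$ implies finiteness of $\varphi(G)$. An action $\circ$ of a group $G$ by isometries on a metric space $(\mathcal S,d)$ is acylindrical if for every $\varepsilon>0$ there exist $R\ge 0$ and $N\ge 0$ such that for every two points $x,y\in\mathcal S$ with $d(x,y)\ge R$ there are at most $N$ elements $g\in G$ satisfying $d(x,g\circ x)\le\varepsilon$ and $d(y,g\circ y)\le\varepsilon$. A group $G$ is acylindrically hyperbolic if it admits a non-elementary acylindrical action on a (Gromov) hyperbolic space; here non-elementary is equivalent to $G$ not being virtually cyclic and the action having unbounded orbits. *)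

(* Defs.v *)
From HB Require Import structures.
From mathcomp Require Import all_boot all_order all_algebra.
From mathcomp Require Import all_classical all_reals all_analysis.
Set Implicit Arguments.
Unset Strict Implicit.
Unset Printing Implicit Defensive.
Import Order.TTheory GRing.Theory Num.Theory.
Local Open Scope classical_set_scope.
Local Open Scope card_scope.
Local Open Scope group_scope.

(* Full (unrestricted) direct product of a family of groups, with pointwise
   operations, over an index type of any cardinality. *)
Definition direct_product (I : Type) (H : I -> groupType) : Type :=
  forall i, H i.

Section DirectProduct.
Variables (I : Type) (H : I -> groupType).
Implicit Types f g h : direct_product H.

HB.instance Definition _ := gen_eqMixin (direct_product H).
HB.instance Definition _ := gen_choiceMixin (direct_product H).

Definition dprod_one : direct_product H := fun i => 1.
Definition dprod_inv f : direct_product H := fun i => (f i)^-1.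
Definition dprod_mul f g : direct_product H := fun i => f i * g i.

Fact dprod_mulA : associative dprod_mul.
Proof. by move=> f g h; apply: functional_extensionality_dep => i; exact: mulgA. Qed.
Fact dprod_mul1g : left_id dprod_one dprod_mul.
Proof. by move=> f; apply: functional_extensionality_dep => i; exact: mul1g. Qed.
Fact dprod_mulg1 : right_id dprod_one dprod_mul.
Proof. by move=> f; apply: functional_extensionality_dep => i; exact: mulg1. Qed.
Fact dprod_mulVg : left_inverse dprod_one dprod_inv dprod_mul.
Proof. by move=> f; apply: functional_extensionality_dep => i; exact: mulVg. Qed.
Fact dprod_mulgV : right_inverse dprod_one dprod_inv dprod_mul.
Proof. by move=> f; apply: functional_extensionality_dep => i; exact: mulgV. Qed.

HB.instance Definition _ := isGroup.Build (direct_product H)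
  dprod_mulA dprod_mul1g dprod_mulg1 dprod_mulVg dprod_mulgV.
End DirectProduct.

Definition torsion_free (G : groupType) : Prop :=
  forall (g : G) (n : nat), (0 < n)%N -> g ^+ n = 1 -> g = 1.

Definition abelian_group (G : groupType) : Prop :=
  forall g h : G, commute g h.

Definition generated_subgroup (G : groupType) (X : set G) : set G :=
  smallest [set H : set G | group_closed (mem H)] X.

(* Finitely many right cosets of [H] cover the group. *)
Definition finite_index (G : groupType) (H : set G) : Prop :=
  exists2 T : set G, finite_set T &
    forall g : G, exists h t, [/\ H h, T t & g = h * t].

Definition virtually_cyclic (G : groupType) : Prop :=
  exists c : G, finite_index (generated_subgroup [set c]).

(* First-order language of groups, without parameters.  The type indices bound
   the free variables: those of [t : term n] and [phi : formula n] lie in 'I_n.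
   Variables are de Bruijn indices: a quantifier binds variable 0. *)
Inductive term (n : nat) : Type :=
| TVar of 'I_n
| TOne
| TMul of term n & term n
| TInv of term n.
Arguments TOne {n}.

Inductive formula : nat -> Type :=
| FEq n of term n & term n : formula n
| FNot n of formula n : formula n
| FAnd n of formula n & formula n : formula n
| FOr n of formula n & formula n : formula n
| FImp n of formula n & formula n : formula n
| FAll n of formula n.+1 : formula n
| FEx n of formula n.+1 : formula n.

(* The assignment sending variable 0 to [x] and variable i.+1 to [v i]. *)
Definition extend (G : Type) (n : nat) (x : G) (v : 'I_n -> G) : 'I_n.+1 -> G :=
  fun i => oapp v x (unlift ord0 i).

Fixpoint eval (G : groupType) (n : nat) (v : 'I_n -> G) (t : term n) : G :=
  match t with
  | TVar i => v i
  | TOne => 1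
  | TMul t u => eval v t * eval v u
  | TInv t => (eval v t)^-1
  end.

Fixpoint sat (G : groupType) (n : nat) (phi : formula n) : ('I_n -> G) -> Prop :=
  match phi in formula n return ('I_n -> G) -> Prop with
  | FEq _ t u => fun v => eval v t = eval v u
  | FNot _ p => fun v => ~ sat p v
  | FAnd _ p q => fun v => sat p v /\ sat q v
  | FOr _ p q => fun v => sat p v \/ sat q v
  | FImp _ p q => fun v => sat p v -> sat q v
  | FAll _ p => fun v => forall x : G, sat p (extend x v)
  | FEx _ p => fun v => exists x : G, sat p (extend x v)
  end.

(* [holds phi g] is phi(g), for a formula with one free variable. *)
Definition holds (G : groupType) (phi : formula 1) (g : G) : Prop :=
  sat phi (fun _ => g).

(* exists y_0 ... y_(r-1), \/_(j < m) /\_(i < k j) w_(j,i)(x, y) # 1, where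
   # is = if [s j i] and <> otherwise; variable 0 of [w j i] stands for x. *)
Definition existential_normal_form (G : groupType) (r m : nat) (k : 'I_m -> nat)
    (w : forall j : 'I_m, 'I_(k j) -> term r.+1)
    (s : forall j : 'I_m, 'I_(k j) -> bool) (x : G) : Prop :=
  exists y : 'I_r -> G, exists j : 'I_m, forall i : 'I_(k j),
    if s j i then eval (extend x y) (w j i) = 1
    else eval (extend x y) (w j i) <> 1.

(* Equivalence is meant in the theory of groups, i.e., in every group. *)
Definition existential (phi : formula 1) : Prop :=
  exists (r m : nat) (k : 'I_m -> nat)
    (w : forall j : 'I_m, 'I_(k j) -> term r.+1)
    (s : forall j : 'I_m, 'I_(k j) -> bool),
  forall (G : groupType) (x : G),
    holds phi x <-> existential_normal_form w s x.

Definition concise (G : groupType) (phi : formula 1) : Prop :=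
  finite_set [set g : G | holds phi g] ->
  finite_set (generated_subgroup [set g : G | holds phi g]).

Section Actions.
Local Open Scope ring_scope.
Variables (R : realType) (G : groupType) (S : metricType R).
Implicit Types (act : G -> S -> S) (x y z w : S).

Definition geodesic_space : Prop :=
  forall x y, exists c : R -> S,
    [/\ c 0 = x, c (mdist x y) = y &
        forall s t : R, 0 <= s <= mdist x y -> 0 <= t <= mdist x y ->
          mdist (c s) (c t) = `|s - t|].

Definition gromov_product w x y : R :=
  (mdist x w + mdist y w - mdist x y) / 2.

(* Hyperbolic spaces are geodesic by convention: without geodesicity the
   inequality alone also admits, e.g., the metric ln (1 + d) for any metric d. *)
Definition gromov_hyperbolic : Prop :=
  geodesic_space /\
  exists delta : R, forall w x y z,
    Num.min (gromov_product w x y) (gromov_product w y z) - delta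
      <= gromov_product w x z.

Definition isometric_action act : Prop :=
  [/\ forall x, act 1%g x = x,
      forall g h x, act (g * h)%g x = act g (act h x) &
      forall g x y, mdist (act g x) (act g y) = mdist x y].

Definition acylindrical act : Prop :=
  forall eps : R, 0 < eps ->
  exists (r : R) (N : nat), 0 <= r /\
    forall x y, r <= mdist x y ->
      [set g : G | mdist x (act g x) <= eps /\ mdist y (act g y) <= eps]
        #<= `I_N.

(* For an isometric action one orbit is unbounded iff the space is nonempty and
   all orbits are; quantifying over all x would be vacuous on the empty space. *)
Definition unbounded_orbits act : Prop :=
  exists x, forall M : R, exists g, M < mdist x (act g x).

End Actions.

Definition non_elementary (R : realType) (G : groupType) (S : metricType R)
    (act : G -> S -> S) : Prop :=
  ~ virtually_cyclic G /\ unbounded_orbits act.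

Definition acylindrically_hyperbolic (R : realType) (G : groupType) : Prop :=
  exists (S : metricType R) (act : G -> S -> S),
    [/\ gromov_hyperbolic S, isometric_action act, acylindrical act &
        non_elementary act].

(* Main.v *)
(* Existential formulas are preserved by injective endomorphisms.  If [phi]
   defines a finite subset of A * K, then conjugation shows that the K-part of
   each of its elements has coordinates with finite conjugacy classes, and the
   injective endomorphisms (a, k) |-> (a ^ n, k) show that its A-part is
   trivial; so it remains to see that a torsion-free acylindrically hyperbolic
   group G has no finite conjugacy class besides that of 1.  Let g <> 1 have
   centralizer C of finite index.  If <g> has a bounded orbit, then all powers
   of g move x and hx boundedly for every h in C, which contradicts
   acylindricity as C has unbounded orbits.  Otherwise some power f of g
   satisfies d(p, f f p) > d(p, f p) + 3 delta at some point p: if not, all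
   small powers of g would barely move the middle part of a long geodesic
   [x, g ^ n x], again contradicting acylindricity.  By a local-to-global
   argument, f then translates along a quasi-geodesic that is coarsely preserved
   by C, and acylindricity makes <f> of finite index in C, so that G is
   virtually cyclic. *)
Require Import Defs.
From mathcomp Require Import all_boot all_order all_algebra.
From mathcomp Require Import all_classical all_reals all_analysis.
From mathcomp Require Import lra zify.

Set Implicit Arguments.
Unset Strict Implicit.
Unset Printing Implicit Defensive.
Import Order.TTheory GRing.Theory Num.Theory.
Local Open Scope classical_set_scope.
Local Open Scope ring_scope.

(** * Gromov products and the four-point condition *)

Section GromovProduct.
Variables (R : realType) (S : metricType R).
Implicit Types (w x y z : S) (delta : R).

(** The minimum is unfolded into a disjunction, so that each use is a case split followed by linear
    arithmetic. *)
Definition delta_hyperbolic delta := forall w x y z,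
  gromov_product w x y <= gromov_product w x z + delta \/
  gromov_product w y z <= gromov_product w x z + delta.

Lemma gromov_hyperbolic_delta : gromov_hyperbolic S ->
  exists2 delta, 0 <= delta & delta_hyperbolic delta.
Proof.
case=> _ [delta hyp].
exists (Num.max delta 0); first by rewrite le_max lexx orbT.
move=> w x y z; have := hyp w x y z.
have : delta <= Num.max delta 0 by rewrite le_max lexx.
by rewrite minEle; case: ifP => _ le_d h; [left|right]; lra.
Qed.

Lemma mdistC x y : mdist x y = mdist y x.
Proof. exact: metric_sym. Qed.

Lemma mdist_triangle x y z : mdist x z <= mdist x y + mdist y z.
Proof. exact: metric_triangle. Qed.

Lemma gromov_productC w x y : gromov_product w x y = gromov_product w y x.
Proof. by rewrite /gromov_product (mdistC x y); lra. Qed.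

Lemma gromov_product_ge0 w x y : 0 <= gromov_product w x y.
Proof.
by have := mdist_triangle x w y; rewrite /gromov_product (mdistC w y); lra.
Qed.

Lemma gromov_product_id w x : gromov_product w x x = mdist x w.
Proof. by rewrite /gromov_product mdistxx; lra. Qed.

Lemma gromov_product0 w x : gromov_product w w x = 0.
Proof. by rewrite /gromov_product mdistxx (mdistC w x); lra. Qed.

Lemma gromov_product_swap w x y :
  gromov_product w x y + gromov_product x w y = mdist w x.
Proof.
by rewrite /gromov_product (mdistC w x) (mdistC y w) (mdistC y x); lra.
Qed.

Lemma gromov_product_ge w x y :
  mdist x w - mdist x y <= gromov_product w x y.
Proof.
by have := mdist_triangle x y w; rewrite /gromov_product; lra.
Qed.

Lemma gromov_product_step w x y z :
  gromov_product w x y <= gromov_product w x z + mdist y z.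
Proof.
have := mdist_triangle y z w; have := mdist_triangle x y z.
by rewrite /gromov_product; lra.
Qed.

End GromovProduct.

(** * Chains with long steps and small turns *)

Section Chain.
Variables (R : realType) (S : metricType R) (delta l e : R) (p : nat -> S).
Hypotheses (delta_ge0 : 0 <= delta) (hyp : delta_hyperbolic S delta).
Hypothesis step : forall i, mdist (p i) (p i.+1) = l.
Hypothesis turn : forall i, gromov_product (p i.+1) (p i) (p i.+2) <= e.
Hypothesis long : 2 * e + 3 * delta < l.

(* A local-to-global principle: long steps with small turning angles (Gromov
   products) make all the points of the chain close to its geodesics. *)
Lemma chain_product_last m n :
  gromov_product (p (m + n).+1) (p m) (p (m + n).+2) <= e + delta.
Proof.
have d0 := delta_ge0; have lg := long.
elim: n => [|n IHn]; first by rewrite addn0; have := turn m; lra.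
rewrite addnS; set k := (m + n)%N in IHn *.
case: (hyp (p k.+2) (p k.+1) (p m) (p k.+3)) => h; have := turn k.+1; last lra.
(* The products at the two ends of a step add up to [l]; by [long] they cannot both be at most
   [e + delta]. *)
have := gromov_product_swap (p k.+2) (p k.+1) (p m).
rewrite (gromov_productC (p k.+1) (p k.+2)) (mdistC (p k.+2)) step.
move: IHn h; lra.
Qed.

Lemma chain_product_first m n :
  gromov_product (p m.+1) (p m) (p (m + n).+2) <= e + delta.
Proof.
have d0 := delta_ge0; have lg := long.
elim: n m => [|n IHn] m; first by rewrite addn0; have := turn m; lra.
rewrite addnS; set y := p (m + n).+3.
case: (hyp (p m.+1) (p m) y (p m.+2)) => h; have := turn m; first lra.
have := IHn m.+1; rewrite addSn -/y.
have := gromov_product_swap (p m.+1) (p m.+2) y.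
rewrite (gromov_productC _ (p m.+2)) step.
by move: h; lra.
Qed.

(** At an interior point, compare both ends with the next point of the chain. If the product with
    [p 0] is not the controlled one, the product with [p n] is at most [e + 2 * delta], yet at least
    [l - e - delta], against [long]. *)
Lemma chain_product i n : (i <= n)%N ->
  gromov_product (p i) (p 0) (p n) <= e + 2 * delta.
Proof.
have d0 := delta_ge0; have lg := long.
have e_ge0 : 0 <= e by exact: le_trans (gromov_product_ge0 _ _ _) (turn 0).
case: i => [_|i]; first by rewrite gromov_product0; lra.
rewrite leq_eqVlt => /orP[/eqP <-|lt_in].
  by rewrite gromov_productC gromov_product0; lra.
have := chain_product_last 0 i; rewrite add0n => lasti.
rewrite leq_eqVlt in lt_in; case/orP: lt_in => [/eqP <-|lt_in]; first lra.
case: (hyp (p i.+1) (p 0%N) (p n) (p i.+2)) => h; first lra.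
have := chain_product_first i.+1 (n - i.+3)%N.
have -> : (i.+1 + (n - i.+3)).+2 = n by lia.
have := gromov_product_swap (p i.+1) (p i.+2) (p n).
by rewrite step; rewrite gromov_productC in h; lra.
Qed.

Lemma chain_growth n : n%:R * (l - 2 * e - 2 * delta) <= mdist (p 0) (p n).
Proof.
have d0 := delta_ge0; have lg := long.
elim: n => [|[_|n IHn]]; first by rewrite mul0r mdist_ge0.
  have e_ge0 : 0 <= e by exact: le_trans (gromov_product_ge0 _ _ _) (turn 0).
  by rewrite mul1r step; lra.
rewrite -natr1; have := chain_product_last 0 n; rewrite add0n /gromov_product.
by rewrite (mdistC (p n.+2)) step; move: IHn; lra.
Qed.

End Chain.

(** Discrete continuity: the product at [z] of [p 0] and [p i] starts large, ends small and varies
    by at most [l] per step. Just before it first becomes small, the products of [p j] with both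
    ends are controlled, which bounds the distance from [z] to [p j]. *)
Lemma near_chain (R : realType) (S : metricType R) (delta l c a : R)
    (p : nat -> S) (z : S) (n : nat) :
  delta_hyperbolic S delta ->
  (forall i, mdist (p i) (p i.+1) = l) ->
  (forall i, (i <= n)%N -> gromov_product (p i) (p 0%N) (p n) <= c) ->
  gromov_product z (p 0%N) (p n) <= a ->
  a + delta < mdist (p 0%N) z -> a + delta < mdist (p n) z ->
  exists i, mdist z (p i) <= 2 * (a + delta) + l + c.
Proof.
move=> hyp step prod prodz far0 farn.
pose P i := (i <= n)%N && (gromov_product z (p 0%N) (p i) <= a + delta).
have exP : exists i, P i.
  exists n; rewrite /P leqnn /=.
  (* The first alternative amounts to [0 <= delta]; the second contradicts that [z] is far from
     [p n]. *)
  case: (hyp z (p 0%N) (p n) (p n)); first lra.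
  by rewrite gromov_product_id; lra.
case: (ex_minnP exP) => -[|j] /andP[le_jn Pj] minj.
  by move: Pj; rewrite gromov_product_id; lra.
have nPj : a + delta < gromov_product z (p 0%N) (p j).
  rewrite ltNge; apply/negP => h; have := minj j.
  by rewrite /P (ltnW le_jn) h ltnn => /(_ isT).
have Qj : gromov_product z (p j) (p n) <= a + delta.
  by case: (hyp z (p 0%N) (p j) (p n)); lra.
exists j; have := gromov_product_step z (p 0%N) (p j) (p j.+1).
have := prod j (ltnW le_jn); move: Qj Pj.
have := mdist_triangle (p 0%N) z (p n).
rewrite step /gromov_product.
by rewrite (mdistC z (p n)) (mdistC z (p j)) (mdistC (p j) (p n)); lra.
Qed.

(** * Isometric and acylindrical actions *)

Section IsometricAction.
Variables (R : realType) (G : groupType) (S : metricType R) (act : G -> S -> S).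
Hypothesis isom : isometric_action act.
Implicit Types (f g h : G) (x y p w : S).

Lemma act_id x : act 1%g x = x.
Proof. by case: isom. Qed.

Lemma act_mul g h x : act (g * h)%g x = act g (act h x).
Proof. by case: isom. Qed.

Lemma mdist_act g x y : mdist (act g x) (act g y) = mdist x y.
Proof. by case: isom. Qed.

Lemma gromov_product_act g w x y :
  gromov_product (act g w) (act g x) (act g y) = gromov_product w x y.
Proof. by rewrite /gromov_product !mdist_act. Qed.

Lemma mdist_actV g x y : mdist x (act g^-1%g y) = mdist (act g x) y.
Proof. by rewrite -(mdist_act g) -act_mul mulgV act_id. Qed.

(** This supplies the second point for acylindricity: displacement by [h] is constant along orbits
    of the centralizer of [h]. *)
Lemma mdist_act_commute g h x :
  commute g h -> mdist (act g x) (act h (act g x)) = mdist x (act h x).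
Proof. by move=> gh; rewrite -act_mul -gh act_mul mdist_act. Qed.

Lemma mdist_actM g h x :
  mdist x (act (g * h)%g x) <= mdist x (act g x) + mdist x (act h x).
Proof.
rewrite act_mul -(mdist_act g x (act h x)); exact: mdist_triangle.
Qed.

Lemma mdist_act_exp g n x :
  mdist x (act (g ^+ n)%g x) <= n%:R * mdist x (act g x).
Proof.
elim: n => [|n IHn]; first by rewrite expg0 act_id mdistxx mul0r.
rewrite expgSr (le_trans (mdist_actM _ _ _))// -natr1 mulrDl mul1r.
exact: lerD.
Qed.

Lemma acylindrical_finite : acylindrical act -> forall eps : R, exists r : R,
  forall x y, r <= mdist x y ->
    finite_set [set g | mdist x (act g x) <= eps /\ mdist y (act g y) <= eps].
Proof.
move=> acyl eps.
have [|r [N [_ card_le]]] := acyl (Num.max eps 1).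
  by rewrite lt_max ltr01 orbT.
exists r => x y /card_le /card_le_finite /(_ (finite_II N)).
by apply: sub_finite_set => g [? ?]; rewrite /= !le_max; split; apply/orP; left.
Qed.

(** * Loxodromic elements and their centralizers *)

Section Loxodromic.
Variables (delta : R) (f : G) (p : S).
Hypotheses (delta_ge0 : 0 <= delta) (hyp : delta_hyperbolic S delta).
Hypothesis lox : mdist p (act f p) + 3 * delta < mdist p (act (f ^+ 2)%g p).

Let l := mdist p (act f p).
(** The turn of the orbit, that is, the Gromov product at [f p] of [p] and [f f p]; thus [lox] is
    exactly [long]. *)
Let e := l - mdist p (act (f ^+ 2)%g p) / 2.
Let orbit i := act (f ^+ i)%g p.

Let step i : mdist (orbit i) (orbit i.+1) = l.
Proof. by rewrite /orbit expgSr act_mul mdist_act. Qed.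

Let turn i : gromov_product (orbit i.+1) (orbit i) (orbit i.+2) <= e.
Proof.
rewrite /gromov_product (mdistC (orbit i.+2)) !step.
rewrite /orbit -addn2 expgnDr act_mul mdist_act /e; lra.
Qed.

Let long : 2 * e + 3 * delta < l.
Proof. by have := lox; rewrite /e -/l; lra. Qed.

Lemma loxodromic_unbounded (M : R) : exists n, M < mdist p (act (f ^+ n)%g p).
Proof.
have eta_gt0 : 0 < l - 2 * e - 2 * delta.
  by have := long; have := delta_ge0; lra.
pose n := Num.truncn (Num.max 0 M / (l - 2 * e - 2 * delta)).
exists n.+1.
have := chain_growth delta_ge0 hyp step turn long n.+1.
rewrite /orbit expg0 act_id; apply: lt_le_trans.
rewrite -ltr_pdivrMr//; apply: le_lt_trans (truncnS_gt _).
by rewrite ler_pM2r ?invr_gt0// le_max lexx orbT.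
Qed.

(** The point is that [D] does not depend on [h]. The orbit and its translate by [h] stay at
    distance [L]; far enough from their ends, hyperbolicity improves this to a bound free of [L]. *)
Lemma loxodromic_commuting_near : exists D : R, forall h, commute h f ->
  exists i j : nat, mdist p (act (f ^- i * h * f ^+ j)%g p) <= D.
Proof.
pose c := e + 2 * delta; pose a := c + 2 * delta.
exists (2 * (a + delta) + l + c) => h hf.
pose L := mdist p (act h p).
have [n far] := loxodromic_unbounded (a + L + c + delta).
have hL i : mdist (orbit i) (act h (orbit i)) = L.
  by rewrite /orbit mdist_act_commute//; exact/commute_sym/commuteX.
have prod i m (le_im : (i <= m)%N) :=
  chain_product delta_ge0 hyp step turn long le_im.
have d0 := delta_ge0.
have e0 : 0 <= e := le_trans (gromov_product_ge0 _ _ _) (turn 0).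
have c0 : 0 <= c by rewrite /c; lra.
have far0 : mdist (orbit n) (orbit 0) = mdist p (act (f ^+ n)%g p).
  by rewrite /orbit expg0 act_id mdistC.
have farn : mdist (orbit n) (orbit (n + n)) = mdist p (act (f ^+ n)%g p).
  by rewrite /orbit expgnDr act_mul mdist_act.
have L0 : 0 <= L by exact: mdist_ge0.
set z := act h (orbit n).
have zprod : gromov_product z (act h (orbit 0)) (act h (orbit (n + n))) <= c.
  by rewrite gromov_product_act; apply: prod; rewrite leq_addr.
have prod_h i : mdist (orbit n) (orbit i) - L
    <= gromov_product z (act h (orbit i)) (orbit i).
  have := gromov_product_ge z (act h (orbit i)) (orbit i).
  by rewrite mdist_act (mdistC (act h _) (orbit i)) hL (mdistC (orbit i)).
(* The translated ends are replaced by the original ones, one at a time, at a cost of [delta] each;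
   the other alternatives contradict [prod_h], [n] being large compared with [L]. *)
have z2 : gromov_product z (orbit 0) (orbit (n + n)) <= c + 2 * delta.
  have h0 := prod_h 0; have hn := prod_h (n + n)%N.
  have [?|h1] := hyp z (act h (orbit 0)) (orbit 0) (act h (orbit (n + n))).
    by move: far; rewrite /a in h0 *; lra.
  have [?|h2] := hyp z (orbit 0) (orbit (n + n)) (act h (orbit (n + n))).
    lra.
  by rewrite gromov_productC in h2; move: far; rewrite /a; lra.
have [||i] := near_chain hyp step (fun i => prod i (n + n)%N) z2.
- have := mdist_triangle (orbit n) z (orbit 0).
  by rewrite hL (mdistC z); move: far; rewrite /a; lra.
- have := mdist_triangle (orbit n) z (orbit (n + n)).
  by rewrite hL (mdistC z); move: far; rewrite /a; lra.
move=> near; exists i, n; apply: le_trans near.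
by rewrite -mulgA act_mul mdist_actV act_mul mdistC.
Qed.

(** The element [f ^- i * h * f ^+ j] moves [p] by at most [D] and, commuting with [f], moves
    [f ^+ m p] no more; for [m] large, acylindricity leaves finitely many such elements. *)
Lemma loxodromic_centralizer : acylindrical act ->
  exists2 F : set G, finite_set F &
    forall h, commute h f -> exists i j u, F u /\ h = (f ^+ i * f ^- j * u)%g.
Proof.
move=> acyl; have [D near] := loxodromic_commuting_near.
have [r finr] := acylindrical_finite acyl D.
have [m far] := loxodromic_unbounded r.
have finF := finr _ _ (ltW far); eexists; first exact: finF.
move=> h hf; have [i [j le_D]] := near h hf.
have hfj : commute h (f ^+ j)%g by exact: commuteX.
exists i, j, (f ^- i * h * f ^+ j)%g; split => /=.
  split=> //; rewrite mdist_act_commute//.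
  by apply: commuteM; [apply: commuteM; [exact/commuteV/commuteX2|
    exact/commute_sym/commuteX]|exact/commuteX2].
have ViVj : commute (f ^- i)%g (f ^- j)%g.
  exact/commute_sym/commuteV/commute_sym/commuteV/commuteX2.
by rewrite -[(f ^- i * h * _)%g]mulgA hfj -!mulgA (mulgA (f ^- j)%g)
  -ViVj -!mulgA mulKg mulVKg.
Qed.

End Loxodromic.

(* If [f] moves [x] little and [p] is far from [x], then moving [p] away from
   [x] forces [f] to move [f p] away from [x] by about the same amount, so a
   large displacement of [p] would make [f] loxodromic. *)
Lemma displacement_le (delta L : R) f x p :
  0 <= delta -> delta_hyperbolic S delta ->
  mdist p (act (f ^+ 2)%g p) <= mdist p (act f p) + 3 * delta ->
  mdist x (act f x) <= L -> L + 6 * delta < mdist x p ->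
  gromov_product p x (act f p) <= delta ->
  mdist p (act f p) <= 9 * delta.
Proof.
move=> d0 hyp nolox le_L far; rewrite /gromov_product => prod.
have t0 := mdist_ge0 x p; have l0 := mdist_ge0 p (act f p).
have := mdist_triangle x p (act (f ^+ 2)%g p).
rewrite (mdistC (act f p) p) in prod.
have := hyp x (act f x) (act f p) (act (f ^+ 2)%g p).
rewrite /gromov_product expg2 !act_mul !mdist_act.
rewrite !(mdistC (act _ _) x); rewrite expg2 act_mul in nolox.
by case; lra.
Qed.

Lemma loxodromic_power (delta : R) g x :
  0 <= delta -> delta_hyperbolic S delta -> geodesic_space S ->
  acylindrical act -> injective (fun n => g ^+ n)%g ->
  (forall M : R, exists n : nat, M < mdist x (act (g ^+ n)%g x)) ->
  exists k p, mdist p (act (g ^+ k)%g p) + 3 * delta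
    < mdist p (act (g ^+ k ^+ 2)%g p).
Proof.
move=> d0 hyp geo acyl g_inj unb; apply: contrapT => nolox.
have {}nolox k p : mdist p (act (g ^+ k ^+ 2)%g p)
    <= mdist p (act (g ^+ k)%g p) + 3 * delta.
  by rewrite leNgt; apply/negP => h; apply: nolox; exists k, p.
have [|r [N [r0 card_le]]] := acyl (9 * delta + 1); first lra.
(* [L] bounds how far the powers up to [N] move either end of the geodesic; [T] is the margin
   required by [displacement_le], and the length [2 * T + r] leaves room for two points at distance
   [r] between the margins. *)
pose L : R := N%:R * mdist x (act g x); pose T := L + 6 * delta + 1.
have L0 : 0 <= L by rewrite mulr_ge0// mdist_ge0.
have [n far] := unb (2 * T + r).
set y := act (g ^+ n)%g x in far; set M := mdist x y in far.
have [c [c0 cM c_iso]] := geo x y.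
have dist_c s t : 0 <= s -> s <= t -> t <= M -> mdist (c s) (c t) = t - s.
  move=> s0 st tM; rewrite c_iso; last 2 first.
  - by rewrite s0 (le_trans st).
  - by rewrite (le_trans s0).
  by rewrite distrC ger0_norm// subr_ge0.
have close s k : T <= s -> s <= M - T -> (k <= N)%N ->
    mdist (c s) (act (g ^+ k)%g (c s)) <= 9 * delta.
  move=> Ts sM kN.
  have le_L : mdist x (act (g ^+ k)%g x) <= L.
    apply: le_trans (mdist_act_exp _ _ _) _.
    by rewrite ler_wpM2r ?mdist_ge0// ler_nat.
  have le_Ly : mdist y (act (g ^+ k)%g y) <= L.
    by rewrite mdist_act_commute//; exact: commuteX2.
  have xs : mdist x (c s) = s.
    by rewrite -{1}c0 dist_c; rewrite /T in Ts sM; lra.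
  have sy : mdist (c s) y = M - s.
    by rewrite -{1}cM -/M dist_c; rewrite /T in Ts sM; lra.
  (* The product of [x] and [y] at a point of the geodesic is 0, so [displacement_le] applies from
     one of the two ends. *)
  have [h|h] := hyp (c s) x (act (g ^+ k)%g (c s)) y.
  - apply: (displacement_le d0 hyp (nolox k _) le_L).
      by rewrite xs; rewrite /T in Ts; lra.
    apply: le_trans h _; rewrite /gromov_product xs (mdistC y) sy -/M; lra.
  - apply: (displacement_le d0 hyp (nolox k _) le_Ly).
      by rewrite (mdistC y) sy; rewrite /T in sM; lra.
    rewrite gromov_productC.
    apply: le_trans h _; rewrite /gromov_product xs (mdistC y) sy -/M; lra.
have T0 : 0 <= T by rewrite /T; lra.
have dpq : r <= mdist (c T) (c (T + r)) by rewrite dist_c; lra.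
have := card_le _ _ dpq; apply/negP.
have sub : [set g ^+ k | k in `I_N.+1]%g `<=`
    [set h | mdist (c T) (act h (c T)) <= 9 * delta + 1 /\
      mdist (c (T + r)) (act h (c (T + r))) <= 9 * delta + 1].
  move=> _ [k kN <-] /=.
  have h1 := @close T k _ _ kN; have h2 := @close (T + r) k _ _ kN.
  by split; [apply: le_trans (h1 _ _) _|apply: le_trans (h2 _ _) _]; lra.
apply/negP => /(card_le_trans (subset_card_le sub)).
rewrite (card_le_eql (inj_card_eq _)); last by move=> ? ? _ _; exact: g_inj.
by rewrite card_le_II ltnn.
Qed.

End IsometricAction.

(** * Centralizers and finite conjugacy classes *)

Section GroupLemmas.
Local Open Scope group_scope.

Lemma expg_inj (G : groupType) (g : G) :
  torsion_free G -> g <> 1 -> injective (fun n => g ^+ n).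
Proof.
move=> tf g1 m n; wlog le_mn : m n / (m <= n)%N => [hw eqg|eqg].
  by case: (leqP m n) => [|/ltnW] le; [|symmetry]; apply: hw.
apply/eqP; rewrite eqn_leq le_mn leqNgt; apply/negP => lt_mn; apply: g1.
by apply: (tf _ (n - m)%N); rewrite ?subn_gt0// expgnFr// -eqg mulgV.
Qed.

(** Orbit-stabilizer: [t] picks, for each conjugate of [g], one element producing it, and
    [h / t (g ^ h)] then fixes [g]. *)
Lemma finite_class_centralizer (G : groupType) (g : G) :
  finite_set (range (fun h => g ^ h)) ->
  exists2 T : set G, finite_set T &
    forall h, exists u t, [/\ commute u g, T t & h = u * t].
Proof.
move=> fin; pose t z := xget 1 [set h | g ^ h = z].
exists (t @` range (fun h => g ^ h)); first exact: finite_image.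
move=> h; have tP : g ^ t (g ^ h) = g ^ h.
  by apply: (@xgetPex _ 1 [set k | g ^ k = g ^ h]); exists h.
exists (h / t (g ^ h)), (t (g ^ h)); split; last by rewrite mulgVK.
  apply/commute_sym/commgP; rewrite -conjg_fix conjgM.
  by rewrite -{1}tP conjgK.
by exists (g ^ h) => //; exists h.
Qed.

Lemma generated_subgroup_expg (G : groupType) (f : G) i j :
  generated_subgroup [set f] (f ^+ i * f ^- j).
Proof.
move=> H [Hgrp /(_ f erefl) Hf].
have HX n : f ^+ n \in mem H.
  case: (Hgrp) => H1 _; elim: n => [|n IHn]; first by rewrite expg0.
  by rewrite expgS; apply: (group_closedM Hgrp) => //; apply/mem_set.
by case: (Hgrp) => _ HV; have := HV _ _ (HX i) (HX j); rewrite inE.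
Qed.

End GroupLemmas.

Lemma finite_class_eq1 (R : realType) (G : groupType) (g : G) :
  acylindrically_hyperbolic R G -> torsion_free G ->
  finite_set (range (fun h => g ^ h)%g) -> g = 1%g.
Proof.
move=> [S [act [hypS isom acyl [nvc [x unb]]]]] tf fin.
apply: contrapT => /(expg_inj tf) g_inj.
have [geo _] := hypS; have [delta d0 hyp] := gromov_hyperbolic_delta hypS.
have [T finT cosets] := finite_class_centralizer fin.
have [unbg|/existsNP[B /forallNP bndg]] :=
    pselect (forall M : R, exists n : nat, M < mdist x (act (g ^+ n)%g x)).
  have [k [p lox]] := loxodromic_power isom d0 hyp geo acyl g_inj unbg.
  have [F finF centr] := loxodromic_centralizer isom d0 hyp lox acyl.
  apply: nvc; exists (g ^+ k)%g; exists [set (u * t)%g | u in F & t in T].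
    exact: finite_image2.
  move=> h; have [u [t [ug Tt ->]]] := cosets h.
  have [i [j [u' [Fu' ->]]]] := centr _ (commuteX k ug).
  exists (g ^+ k ^+ i * g ^+ k ^- j)%g, (u' * t)%g; split.
  - exact: generated_subgroup_expg.
  - by exists u' => //; exists t.
  - by rewrite !mulgA.
have [r finr] := acylindrical_finite acyl B.
have [s Ts] : exists s : seq G, T = [set` s] by exact/finite_seqP.
(* [b] bounds the displacement of [x] by coset representatives, so an [h] moving [x] beyond [r + b]
   has a centralizing factor [u] moving [x] by at least [r]. *)
pose b := \big[Num.max/0]_(t <- s) mdist x (act t x).
have [h far] := unb (r + b); have [u [t [ug Tt eh]]] := cosets h.
have le_b : mdist x (act t x) <= b.
  rewrite Ts in Tt.
  exact: (@le_bigmax_seq _ R _ s 0 t xpredT (fun u => mdist x (act u x)) Tt).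
have far_u : r <= mdist x (act u x).
  by have := mdist_actM isom u t x; rewrite -eh; lra.
apply: infinite_nat; rewrite -(eq_finite_set (inj_card_eq (in2W g_inj))).
apply: sub_finite_set (finr _ _ far_u) => _ [n _ <-] /=.
rewrite mdist_act_commute//; last exact: commuteX.
by have := bndg n; move=> /negP; rewrite -leNgt.
Qed.

(** * Existential formulas and the direct product *)

Section ExistentialEmbedding.
Local Open Scope group_scope.
Variables (G G' : groupType) (s : G -> G').
Hypotheses (sM : {morph s : x y / x * y}) (s_inj : injective s).

Lemma morph_one : s 1 = 1.
Proof. by apply: (mulgI (s 1)); rewrite -sM !mulg1. Qed.

Lemma eval_morph n (v : 'I_n -> G) (t : term n) :
  Defs.eval (s \o v) t = s (Defs.eval v t).
Proof.
elim: t => [i||t IHt u IHu|t IHt] //=; first by rewrite morph_one.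
  by rewrite IHt IHu sM.
by rewrite IHt; apply: mulg1_eq; rewrite -sM mulgV morph_one.
Qed.

Lemma extend_comp n (x : G) (v : 'I_n -> G) :
  extend (s x) (s \o v) = s \o extend x v.
Proof. by apply/funext => i; rewrite /extend /=; case: unlift. Qed.

(** Witnesses are transported by [s]: equations survive because [s] is a morphism, inequations
    because it is injective. *)
Lemma existential_embedding (phi : formula 1) x :
  existential phi -> holds phi x -> holds phi (s x).
Proof.
case=> r [m [k [w [b phiE]]]] /phiE[y [j lits]].
apply/phiE; exists (s \o y), j => i; have := lits i.
rewrite extend_comp eval_morph.
by case: (b j i) => [->|ne1]; [exact: morph_one|rewrite -morph_one => /s_inj].
Qed.

End ExistentialEmbedding.

Section DirectProductCoordinate.
Local Open Scope group_scope.
Variables (I : Type) (H : I -> groupType) (i : I).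

Definition dprod_single (u : H i) : direct_product H := fun j =>
  if pselect (i = j) is left e then eq_rect i H u j e else 1.

Lemma dprod_single_coord u : dprod_single u i = u.
Proof.
by rewrite /dprod_single; case: pselect => // e;
  rewrite (Prop_irrelevance e erefl).
Qed.

End DirectProductCoordinate.

Theorem corollary1p2 (R : realType) (A : groupType) (I : Type)
    (H : I -> groupType)
    (A_abelian : abelian_group A) (A_torsion_free : torsion_free A)
    (H_torsion_free : forall i : I, torsion_free (H i))
    (H_acyl_hyp : forall i : I, acylindrically_hyperbolic R (H i))
    (phi : formula 1) (phi_existential : existential phi) :
  concise (A * direct_product H)%type phi.
Proof.
(* Finiteness forces more: only 1 can satisfy [phi], so the generated subgroup is trivial. *)
move=> fin; apply: (@sub_finite_set _ _ [set 1%g]) (finite_set1 _).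
apply: smallest_sub.
  split; first exact/mem_set.
  move=> u v /set_mem -> /set_mem ->; apply/mem_set.
  by rewrite /= invg1 mulg1.
move=> [a k] phi_ak /=.
have -> : k = 1%g.
  apply: functional_extensionality_dep => i.
  apply: (finite_class_eq1 (H_acyl_hyp i) (H_torsion_free i)).
  apply: sub_finite_set (finite_image (fun z => z.2 i) fin) => _ [u _ <-] /=.
  (* Conjugating by [v] realizes the conjugate of [k i] by [u] as a coordinate of an element
     satisfying [phi]. *)
  pose v : A * direct_product H := (1%g, dprod_single u).
  exists ((a, k) ^ v)%g; last first.
    by rewrite -[in RHS](dprod_single_coord u).
  apply: (existential_embedding _ (@conjg_inj _ v)) => //.
  by move=> x y; exact: conjMg.
congr pair; apply: contrapT => /(expg_inj A_torsion_free) a_inj.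
apply: infinite_nat.
(* The exponent [n.+1] is never 0, so [pow n] is injective by torsion-freeness; it is a morphism
   because [A] is abelian. *)
pose pow n (z : A * direct_product H) := ((z.1 ^+ n.+1)%g, z.2).
have powM n : {morph pow n : x y / (x * y)%g}.
  by move=> x y; rewrite /pow /= expgMn.
have pow_inj n : injective (pow n).
  move=> [x1 x2] [y1 y2] [eqX ->]; congr pair.
  apply/eqP; rewrite -divg_eq1; apply/eqP.
  by apply: (A_torsion_free _ n.+1) => //; rewrite expgnFl// eqX mulgV.
have sub : [set pow n (a, k) | n in setT] `<=` [set z | holds phi z].
  move=> _ [n _ <-].
  exact: (existential_embedding (powM n) (pow_inj n) phi_existential phi_ak).
have /inj_card_eq E : {in setT &, injective (fun n => pow n (a, k))}.
  by move=> m n _ _ [/a_inj[]].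
by rewrite -(eq_finite_set E); exact: sub_finite_set sub fin.
Qed.
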